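(* Let $\alpha>0$ and $1\le p<\infty$. Let $\varphi(z)=a+\lambda z$, where $a\in\mathbb{C}$, $\lambda\in\mathbb{R}$, $-1<\lambda<1$ and $\lambda\ne0$, and put $\beta=1-|\lambda|^2$. Let $\psi(z)=e^{a_0+a_1z+a_2z^2}$ with $a_0,a_1,a_2\in\mathbb{C}$ and $|a_2|=\frac{\alpha}{2}\beta$. Suppose that the weighted composition operator $W_{\psi,\varphi}f=\psi\cdot(f\circ\varphi)$ is bounded on $\mathcal{F}^p_\alpha$. Let $z_0=a/(1-\lambda)$ be the fixed point of $\varphi$. If $f\in\mathcal{F}^p_\alpha$ with $f(z_0)\ne0$, then $$|\psi(z_0)|^{-n}\,\|W_{\psi,\varphi}^nf\|\longrightarrow\infty\quad\text{as } n\to\infty.$$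
   Context: For $\alpha>0$ and $1\le p<\infty$, the Fock space $\mathcal{F}^p_\alpha$ is the Banach space of entire functions $f:\mathbb{C}\to\mathbb{C}$ with finite norm $\|f\|=\left(\frac{\alpha p}{2\pi}\int_{\mathbb{C}}|f(z)|^p e^{-\frac{\alpha p}{2}|z|^2}\,dm(z)\right)^{1/p}$, where $dm$ is area measure on $\mathbb{C}$. Boundedness of $W_{\psi,\varphi}$ on $\mathcal{F}^p_\alpha$ means it maps $\mathcal{F}^p_\alpha$ into itself and is a bounded linear operator there. $W_{\psi,\varphi}^n$ is the $n$-th iterate (power) of the operator. *)

(* Defs.v *)
From HB Require Import structures.
From mathcomp Require Import all_boot all_order all_algebra.
From mathcomp Require Import all_classical all_reals all_analysis.
From mathcomp Require Import complex.
Set Implicit Arguments.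
Unset Strict Implicit.
Unset Printing Implicit Defensive.
Import Order.TTheory GRing.Theory Num.Theory.
Import numFieldNormedType.Exports.
Import Normc.
Local Open Scope classical_set_scope.
Local Open Scope ring_scope.
Local Open Scope complex_scope.

(* The modulus of z : R[i] is written [normc z], which lives in R; the generic
   norm [`|z|] lives in R[i]. *)

Definition expC (R : realType) (z : R[i]) : R[i] :=
  (expR (complex.Re z))%:C * (cos (complex.Im z) +i* sin (complex.Im z)).

(* R[i]^o is R[i] as a normed module over itself, so that the difference
   quotient is taken along complex increments. *)
Definition entire (R : realType) (f : R[i] -> R[i]) : Prop :=
  forall z : R[i], derivable (f : R[i]^o -> R[i]^o) z 1.

(* Area measure on C is Lebesgue measure on R * R, via (x, y) |-> x + iy. *)
Definition fock_integral (R : realType) (alpha p : R) (f : R[i] -> R[i]) :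
    \bar R :=
  (\int[(@lebesgue_measure R) \x (@lebesgue_measure R)]_(w in [set: R * R])
     (normc (f (w.1 +i* w.2)) `^ p
      * expR (- (alpha * p / 2) * normc (w.1 +i* w.2) ^+ 2))%:E)%E.

Definition fock_space (R : realType) (alpha p : R) : set (R[i] -> R[i]) :=
  [set f | entire f /\ (fock_integral alpha p f < +oo)%E].

(* [fine] sends +oo to 0, so this is only meaningful on [fock_space]. *)
Definition fock_norm (R : realType) (alpha p : R) (f : R[i] -> R[i]) : R :=
  (alpha * p / (2 * pi) * fine (fock_integral alpha p f)) `^ p^-1.

Definition fock_bounded (R : realType) (alpha p : R)
    (T : (R[i] -> R[i]) -> (R[i] -> R[i])) : Prop :=
  [/\ forall f, fock_space alpha p f -> fock_space alpha p (T f),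
      forall (c : R[i]) f g, fock_space alpha p f -> fock_space alpha p g ->
        forall z, T (fun w => c * f w + g w) z = c * T f z + T g z
    & exists M : R, forall f, fock_space alpha p f ->
        fock_norm alpha p (T f) <= M * fock_norm alpha p f].

Definition weighted_comp (R : realType) (psi phi : R[i] -> R[i])
    (f : R[i] -> R[i]) : R[i] -> R[i] :=
  fun z => psi z * f (phi z).

(* Main.v *)
(* Centred at the fixed point [z0], the iterates are explicit Gaussians times
   [f (z0 + lambda ^+ n * w)], and [|psi z0| ^- n * W ^n f] converges locally
   uniformly to [f z0 * exp (c * w + A * w ^+ 2)] with [|A| = alpha / 2].  In a
   direction [d] where [A * d ^+ 2 = alpha / 2], the quadratic terms of this
   Gaussian cancel against those of the weight, and the sign of [d] can be
   chosen so that the remaining linear term is nonnegative.  Hence the weighted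
   limit stays away from [0] on infinitely many disjoint squares of side [2] centred
   on the ray [z0 + t * d], and its norm is infinite.  Boundedness of [W] is only
   used to know that the norms of the iterates are finite. *)
Require Import Defs.
From HB Require Import structures.
From mathcomp Require Import all_boot all_order all_algebra.
From mathcomp Require Import all_classical all_reals all_analysis.
From mathcomp Require Import complex.
From mathcomp Require Import ring lra.
Set Implicit Arguments.
Unset Strict Implicit.
Unset Printing Implicit Defensive.
Import Order.TTheory GRing.Theory Num.Theory.
Import numFieldNormedType.Exports.
Import Normc.
Local Open Scope classical_set_scope.
Local Open Scope ring_scope.
Local Open Scope complex_scope.

(** * Lower bounds for integrals *)

Section LowerIntegral.
Import HBNNSimple.

(** The integral is the supremum over simple functions below [f], and [M] times the indicator of [A]
    is one of them. *)
Lemma ge0_integral_ge_on d (T : measurableType d) (R : realType)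
    (mu : {measure set T -> \bar R}) (A : set T) (M : R) (f : T -> R) :
  measurable A -> 0 <= M -> (forall x, 0 <= f x) ->
  (forall x, A x -> M <= f x) ->
  (M%:E * mu A <= \int[mu]_(x in setT) (f x)%:E)%E.
Proof.
move=> mA M0 f0 Mf; rewrite ge0_integralTE => [|x]; last by rewrite lee_fin.
apply: ereal_sup_ubound; exists (scale_nnsfun (indic_nnsfun R mA) M0).
  move=> x /=; rewrite lee_fin /= measurable_realfun.mindicE.
  by have [/set_mem/Mf|_] := boolP (x \in A); rewrite ?mulr1 ?mulr0.
by rewrite -sintegral_indic -(sintegralrM mu M (indic_nnsfun R mA)).
Qed.

End LowerIntegral.

(** * Complex exponential, iterates, and the critical direction *)

Section ComplexExp.
Variable R : realType.
Implicit Types z w : R[i].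

Lemma ReD z w : complex.Re (z + w) = complex.Re z + complex.Re w.
Proof. by case: z w => [a b] [c d]. Qed.

Lemma normc_sqr z : normc z ^+ 2 = complex.Re z ^+ 2 + complex.Im z ^+ 2.
Proof. by case: z => a b; rewrite sqr_sqrtr // addr_ge0 ?sqr_ge0. Qed.

Lemma normc_ge0 z : 0 <= normc z.
Proof. by case: z => a b; exact: sqrtr_ge0. Qed.

Lemma normc_real (r : R) : normc r%:C = `|r|.
Proof. by rewrite /= expr0n /= addr0 sqrtr_sqr. Qed.

Lemma normr_Re_le_normc z : `|complex.Re z| <= normc z.
Proof.
by rewrite -sqrtr_sqr; case: z => a b /=; rewrite ler_wsqrtr // lerDl sqr_ge0.
Qed.

Lemma expCD z w : expC (z + w) = expC z * expC w.
Proof.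
case: z w => [a b] [c d]; apply/eqP; rewrite eq_complex; simpc => /=.
by rewrite expRD cosD sinD; apply/andP; split; apply/eqP; ring.
Qed.

Lemma normc_expC z : normc (expC z) = expR (complex.Re z).
Proof.
case: z => a b; rewrite normcM normc_real ger0_norm ?expR_ge0 //=.
by rewrite cos2Dsin2 sqrtr1 mulr1.
Qed.

Lemma normc_expC_natmul z n : normc (expC (n%:R * z)) = normc (expC z) ^+ n.
Proof.
rewrite !normc_expC -expRM_natl; congr expR.
by rewrite !mulr_natl; elim: n => [|n IHn]; rewrite ?mulr0n // !mulrS ReD IHn.
Qed.

(** Continuity at [z] with tolerance half of the modulus of [f z]. *)
Lemma entire_normc_ge_half (f : R[i] -> R[i]) z : entire f -> f z != 0 ->
  exists2 e : R, 0 < e &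
    forall h, normc h < e -> normc (f z) / 2 <= normc (f (z + h)).
Proof.
move=> /(_ z)/derivable1_diffP/differentiable_continuous fz fz0.
have nfz : 0 < normc (f z).
  rewrite lt_def normc_ge0 andbT; apply: contra_neq fz0; exact: eq0_normc.
have r0 : 0 < (normc (f z) / 2)%:C :> R[i]^o by rewrite ltcR divr_gt0.
have /cvgrPdist_lt /(_ _ r0) /nbhs_normP[e /= e0 ef] := fz.
have eR : (complex.Re e)%:C = e by rewrite RRe_real // gtr0_real.
exists (complex.Re e) => [|h he]; first by rewrite -ltcR eR.
have : `|f z - f (z + h)| < (normc (f z) / 2)%:C.
  apply: ef => /=; rewrite opprD addNKr normrN -eR.
  by rewrite (_ : `|h| = (normc h)%:C) ?ltcR.
rewrite (_ : `|_| = (normc (f z - f (z + h)))%:C) // ltcR => fh.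
have := le_normcD (f z - f (z + h)) (f (z + h)); rewrite subrK; lra.
Qed.

(* At the fixed point [z0] the linear and quadratic coefficients of [log psi]
   are divided by [1 - lambda] and [1 - lambda ^+ 2], so that the exponents of the
   iterates telescope. *)
Lemma iter_weighted_comp_affine (psi phi f : R[i] -> R[i]) (z0 l q c A w : R[i])
    n :
  (forall w, phi (z0 + w) = z0 + l * w) ->
  (forall w, psi (z0 + w) =
             expC (q + (1 - l) * c * w + (1 - l ^+ 2) * A * w ^+ 2)) ->
  iter n (weighted_comp psi phi) f (z0 + w) =
  expC (n%:R * q + ((1 - l ^+ n) * (c * w) + (1 - l ^+ n ^+ 2) * (A * w ^+ 2)))
  * f (z0 + l ^+ n * w).
Proof.
move=> phiE psiE; elim: n w => [|n IHn] w.
  rewrite !expr0 expr1n subrr mul1r !mul0r !addr0 /expC /= expR0 sin0 cos0.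
  by rewrite !mul1r.
rewrite iterS {1}/weighted_comp phiE IHn psiE mulrA -expCD.
congr (expC _ * f _).
  by rewrite -natr1 (exprS l n); ring.
by rewrite (exprSr l n); ring.
Qed.

(** A square root [d] of [A^*%C / r%:C] has modulus 1 and satisfies [A * d ^+ 2 = r%:C]. The same
    holds for [- d], so the sign is free to fix the last condition. *)
Lemma unit_maximizing_direction (r : R) (A u : R[i]) : 0 < r -> normc A = r ->
  exists d : R[i], [/\ normc d = 1, A * d = r%:C * d^*%C
                     & 0 <= complex.Re (d * u)].
Proof.
move=> r0 nA; have rC0 : r%:C != 0 :> R[i] by rewrite fmorph_eq0 gt_eqF.
pose d := sqrtc (A^*%C / r%:C).
have d2 : d ^+ 2 = A^*%C / r%:C by rewrite sqr_sqrtc.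
have nd : normc d = 1.
  apply/eqP; rewrite -sqrp_eq1 ?normc_ge0 //; apply/eqP.
  rewrite expr2 -normcM -expr2 d2 normcM normcV normc_real gtr0_norm //.
  rewrite (_ : normc A^*%C = r) ?divff ?gt_eqF // -nA.
  by case: (A) => x y /=; rewrite sqrrN.
have Ad : A * d = r%:C * d^*%C.
  have dd : d * d^*%C = 1.
    by rewrite -sqr_normc (_ : `|d| = (normc d)%:C) // nd expr1n.
  have AA : A * A^*%C = r%:C ^+ 2.
    by rewrite -sqr_normc (_ : `|A| = (normc A)%:C) // nA.
  rewrite -[LHS]mulr1 -dd mulrACA mulrA -(mulrA A) -expr2 d2 mulrA AA.
  by rewrite expr2 mulfK.
have [du|du] := leP 0 (complex.Re (d * u)); first by exists d.
exists (- d); split; rewrite ?normcN // ?mulrN ?Ad ?rmorphN ?mulrN //.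
by rewrite mulNr raddfN oppr_ge0 ltW.
Qed.
End ComplexExp.

(** * The limiting Gaussian on squares along a line *)

Section GaussianSquares.
Variable R : realType.

Lemma ler_normM_le1 (x y : R) : `|y| <= 1 -> `|x * y| <= `|x|.
Proof. by move=> y1; rewrite normrM ler_piMr. Qed.

(** Expanded in [t], the square term and the cross terms [t * h] contain the factor
    [A * d - r%:C * d^*%C = 0]. The term linear in [t] is nonnegative by the choice of [d], and what
    remains depends only on the bounded [h]. *)
Lemma gaussian_exponent_lower_bound (r : R) (c A z0 d : R[i]) : 0 < r ->
  normc d = 1 -> A * d = r%:C * d^*%C ->
  0 <= complex.Re (d * (c - (2 * r)%:C * z0^*%C)) ->
  exists C : R, forall (t : R) (h : R[i]), 0 <= t ->
    `|complex.Re h| <= 1 -> `|complex.Im h| <= 1 ->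
    let w := t%:C * d + h in
    - C <= complex.Re (c * w + A * w ^+ 2) - r * normc (z0 + w) ^+ 2.
Proof.
case: c A z0 d => [c1 c2] [A1 A2] [x y] [dx dy] r0 nd.
have {nd} : dx ^+ 2 + dy ^+ 2 = 1.
  by have := normc_sqr (dx +i* dy); rewrite nd expr1n => ->.
move=> nd; simpc => -[Ad1 Ad2]; simpc => /= L0.
exists (`|c1| + `|c2| + `|A1| + 2 * `|A2| +
        r * ((`|x| + 1) ^+ 2 + (`|y| + 1) ^+ 2)) => t [u v] t0 u1 v1.
rewrite normc_sqr expr2; move: u1 v1; simpc => /= u1 v1.
set G := (X in _ <= X).
(* [E1] and [E2] are the real and imaginary parts of [A * d - r%:C * d^*%C]. *)
pose E1 := A1 * dx - A2 * dy - r * dx.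
pose E2 := A1 * dy + A2 * dx + r * dy.
have E10 : E1 = 0 by rewrite /E1 Ad1 subrr.
have E20 : E2 = 0 by rewrite /E2 Ad2; ring.
have -> : G = t * (dx * (c1 - 2 * r * x) - dy * (c2 + 2 * r * y))
  + (c1 * u - c2 * v + A1 * (u * u - v * v) - 2 * (A2 * (u * v))
     - r * ((x + u) ^+ 2 + (y + v) ^+ 2))
  + t ^+ 2 * (dx * E1 - dy * E2)
  + 2 * t * (u * E1 - v * E2) by rewrite /G /E1 /E2; ring.
rewrite E10 E20.
have := ler_normM_le1 c1 u1; have := ler_normM_le1 c2 v1.
have uv1 : `|u * v| <= 1 by rewrite normrM mulr_ile1.
have := ler_normM_le1 A2 uv1.
have uuvv : `|u * u - v * v| <= 1.
  move: u1 v1; rewrite !ler_norml => *; nra.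
have := ler_normM_le1 A1 uuvv.
have sq (a b : R) : `|b| <= 1 -> (a + b) ^+ 2 <= (`|a| + 1) ^+ 2.
  move=> b1; rewrite -(real_normK (num_real (a + b))).
  rewrite lerXn2r ?nnegrE ?addr_ge0 //.
  by apply: le_trans (ler_normD _ _) _; rewrite lerD2l.
have := ler_wpM2l (ltW r0) (lerD (sq x u u1) (sq y v v1)).
have tL : 0 <= t * (dx * (c1 - 2 * r * x) - dy * (c2 + 2 * r * y)).
  by apply: mulr_ge0 => //; move: L0; rewrite !mulNr !opprK; lra.
rewrite !ler_norml; lra.
Qed.

Definition square_at (x y : R) : set (R * R) :=
  `[x - 1, x + 1] `*` `[y - 1, y + 1].

Lemma square_atP (x y u v : R) :
  square_at x y (u, v) <-> `|u - x| <= 1 /\ `|v - y| <= 1.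
Proof. by rewrite /square_at /= !in_itv /= !ler_distl. Qed.

Lemma measurable_square_at x y : measurable (square_at x y).
Proof. by apply: measurableX; exact: measurable_itv. Qed.

Lemma measure_square_at x y :
  ((@lebesgue_measure R) \x (@lebesgue_measure R))%E (square_at x y) = 4%:E.
Proof.
rewrite /square_at product_measure1E ?measurable_itv //.
have len2 (a : R) : lebesgue_measure (`[a - 1, a + 1] : set R) = 2%:E.
  by rewrite lebesgue_measure_itv /= lte_fin ifT -?EFinB; [congr EFin; ring|lra].
by rewrite [LHS](congr2 *%E (len2 x) (len2 y)) -EFinM; congr EFin; ring.
Qed.

(** Distinct centres are at distance at least 4, whereas two squares of side 2 that meet have
    centres at distance at most the square root of 8. *)
Lemma measure_squares_on_line (x y dx dy : R) N : dx ^+ 2 + dy ^+ 2 = 1 ->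
  ((@lebesgue_measure R) \x (@lebesgue_measure R))%E
    (\big[setU/set0]_(k < N) square_at (x + 4 * k%:R * dx) (y + 4 * k%:R * dy))
  = (4 * N%:R)%:E.
Proof.
move=> nd; pose F k := square_at (x + 4 * k%:R * dx) (y + 4 * k%:R * dy).
transitivity (\sum_(k < N)
    ((@lebesgue_measure R) \x (@lebesgue_measure R)) (F k))%E; last first.
  rewrite /F; under eq_bigr do rewrite measure_square_at.
  by rewrite sumEFin sumr_const card_ord mulr_natr.
have sigma_add := @measure_bigsetU _ _ _
  ((@lebesgue_measure R) \x (@lebesgue_measure R))%E F.
apply sigma_add => [k|]; first exact: measurable_square_at.
apply/trivIsetP => i j _ _ ij; rewrite -subset0 => -[u v] [].
move=> /square_atP[ui vi] /square_atP[uj vj].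
have m1 : 1 <= (i%:R - j%:R) ^+ 2 :> R.
  have [ltij|ltij|/eqP] := ltngtP i j; last by rewrite (negPf ij).
    have : i.+1%:R <= j%:R :> R by rewrite ler_nat.
    by rewrite -natr1; nra.
  have : j.+1%:R <= i%:R :> R by rewrite ler_nat.
  by rewrite -natr1; nra.
set m : R := i%:R - j%:R in m1.
have sq_le (s : R) : - (1 / 2) <= s -> s <= 1 / 2 -> s ^+ 2 <= 1 / 4.
  by move=> *; nra.
move: ui vi uj vj; rewrite !ler_distl.
move=> /andP[u1 u2] /andP[v1 v2] /andP[u3 u4] /andP[v3 v4].
(* A common point forces both coordinates of [4 * m * d] to be at most 2 in absolute value, hence
   [m ^+ 2 <= 1 / 2], against [m1]. *)
have mx : (m * dx) ^+ 2 <= 1 / 4 by apply: sq_le; rewrite /m; lra.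
have my : (m * dy) ^+ 2 <= 1 / 4 by apply: sq_le; rewrite /m; lra.
have : (m * dx) ^+ 2 + (m * dy) ^+ 2 = m ^+ 2.
  by rewrite !exprMn -mulrDr nd mulr1.
lra.
Qed.
End GaussianSquares.

(** * A uniform lower bound for the normalized iterates *)

Section Growth.
Variables (R : realType) (alpha p lambda : R).
Hypotheses (halpha : 0 < alpha) (hp : 1 <= p) (hlambda : `|lambda| < 1).
Variables (c A z0 : R[i]) (f : R[i] -> R[i]).
Hypotheses (hA : normc A = alpha / 2) (hf : entire f) (hfz0 : f z0 != 0).

(* [w |-> psi z0 ^- n * (W ^n f) (z0 + w)] *)
Definition normalized_iter (n : nat) (w : R[i]) : R[i] :=
  let l := lambda%:C in
  expC ((1 - l ^+ n) * (c * w) + (1 - l ^+ n ^+ 2) * (A * w ^+ 2))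
  * f (z0 + l ^+ n * w).

Lemma normc_le2 (h : R[i]) :
  `|complex.Re h| <= 1 -> `|complex.Im h| <= 1 -> normc h <= 2.
Proof.
move=> h1 h2; rewrite -(@ler_pXn2r _ 2) ?nnegrE ?normc_ge0 // normc_sqr.
by move: h1 h2; rewrite !ler_norml => *; nra.
Qed.

(** The two exponents differ by the real part of [s * u + s ^+ 2 * v], and [s ^+ 2 <= |s|]. It is
    applied with [s = lambda ^+ n]. *)
Lemma Re_exponent_ge (s K : R) (u v : R[i]) : `|s| <= 1 ->
  `|s| * (normc u + normc v) <= K ->
  complex.Re (u + v) - K <=
  complex.Re ((1 - s%:C) * u + (1 - s%:C ^+ 2) * v).
Proof.
move=> s1 sK.
have Rl (t : R) (x : R[i]) : complex.Re (t%:C * x) = t * complex.Re x.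
  by case: x => x y; simpc.
have -> : (1 - s%:C) * u + (1 - s%:C ^+ 2) * v =
          (1 - s)%:C * u + (1 - s ^+ 2)%:C * v.
  by rewrite !rmorphB rmorphXn rmorph1.
have su : s * complex.Re u <= `|s| * normc u.
  by rewrite (le_trans (ler_norm _)) // normrM ler_wpM2l ?normr_Re_le_normc.
have sv : s ^+ 2 * complex.Re v <= `|s| * normc v.
  rewrite (le_trans (ler_norm _)) // normrM ler_pM ?normr_Re_le_normc //.
  by rewrite normrX expr2 ler_piMr.
by rewrite !ReD !Rl; lra.
Qed.

(** The first [N] squares lie in a bounded region, where the normalized iterates are close to their
    limit for large [n]. The order of quantifiers matters: [delta] does not depend on [N], only the
    threshold for [n] does. *)
Lemma normalized_iter_lower_bound :
  exists d : R[i], normc d = 1 /\ exists2 delta : R, 0 < delta &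
    forall N : nat, \forall n \near \oo, forall (k : nat) (h : R[i]),
      (k < N)%N -> `|complex.Re h| <= 1 -> `|complex.Im h| <= 1 ->
      let w := (4 * k%:R)%:C * d + h in
      delta <= normc (normalized_iter n w) `^ p
               * expR (- (alpha * p / 2) * normc (z0 + w) ^+ 2).
Proof.
have r0 : 0 < alpha / 2 by rewrite divr_gt0.
have p0 : 0 <= p by rewrite (le_trans _ hp).
have [d [nd Ad Lge0]] :=
  unit_maximizing_direction (c - (2 * (alpha / 2))%:C * z0^*%C) r0 hA.
have [C HC] := gaussian_exponent_lower_bound r0 nd Ad Lge0.
have [e e0 fe] := entire_normc_ge_half hf hfz0.
have nf0 : 0 < normc (f z0) / 2.
  rewrite divr_gt0 // lt_def normc_ge0 andbT; apply: contra_neq hfz0.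
  exact: eq0_normc.
(* [C] bounds the limiting exponent, the extra 1 absorbs the error at finite [n], and the half comes
   from the continuity of [f] at [z0]. *)
exists d; split => //; exists (expR (- (C + 1) * p) * (normc (f z0) / 2) `^ p).
  by rewrite mulr_gt0 ?expR_gt0 ?powR_gt0.
move=> N; pose M : R := 4 * N%:R + 2.
have M0 : 0 < M by rewrite ltr_wpDl ?mulr_ge0.
(* [M] bounds the modulus of [w]. Once [|s| * (K + 1) < 1], the first summand keeps [s * w] within
   radius [e], and the second keeps the error of the exponent below 1. *)
pose K := M / e + (normc c * M + normc A * M ^+ 2).
have K0 : 0 <= M / e by rewrite divr_ge0 ?ltW.
have K1 : 0 <= normc c * M + normc A * M ^+ 2.
  by rewrite addr_ge0 ?mulr_ge0 ?normc_ge0 ?exprn_ge0 ?ltW.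
have Kp : 0 < (K + 1)^-1 by rewrite invr_gt0 /K; lra.
have /cvgrPdist_lt /(_ _ Kp) := cvg_expr hlambda.
apply: filterS => n; rewrite sub0r normrN => sn k h kN h1 h2.
set w := (4 * k%:R)%:C * d + h.
set s := lambda ^+ n in sn.
have s1 : `|s| <= 1 by rewrite normrX exprn_ile1 // ltW.
have sK : `|s| * (K + 1) < 1 by rewrite -ltr_pdivlMr ?div1r // /K; lra.
have wM : normc w <= M.
  apply: le_trans (le_normcD _ _) _; rewrite lerD ?normc_le2 // normcM nd mulr1.
  by rewrite normc_real ger0_norm ?mulr_ge0 // ler_pM2l // ler_nat ltnW.
rewrite /normalized_iter -rmorphXn -/s.
have fw : normc (f z0) / 2 <= normc (f (z0 + s%:C * w)).
  apply: fe; rewrite normcM normc_real.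
  have sM : `|s| * (M / e) < 1.
    apply: le_lt_trans sK; rewrite ler_wpM2l // /K; lra.
  apply: le_lt_trans (ler_wpM2l (normr_ge0 s) wM) _.
  by rewrite -[e]mul1r -ltr_pdivrMr // -mulrA.
rewrite normcM normc_expC (powRM _ (expR_ge0 _)) ?normc_ge0 // -expRM.
rewrite mulrAC -expRD.
apply: ler_pM; rewrite ?expR_ge0 ?powR_ge0 //; last first.
  by apply: ge0_ler_powR; rewrite ?nnegrE ?normc_ge0 // ltW.
rewrite ler_expR.
have Cw : - C <= complex.Re (c * w + A * w ^+ 2)
                - alpha / 2 * normc (z0 + w) ^+ 2.
  by apply: HC; rewrite ?mulr_ge0.
have scA : `|s| * (normc (c * w) + normc (A * w ^+ 2)) <= 1.
  apply: le_trans (ltW sK); rewrite ler_wpM2l // /K.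
  have cw : normc (c * w) <= normc c * M.
    by rewrite normcM ler_wpM2l ?normc_ge0.
  have Aw : normc (A * w ^+ 2) <= normc A * M ^+ 2.
    rewrite normcM (expr2 w) normcM ler_wpM2l ?normc_ge0 // -expr2.
    by rewrite lerXn2r ?nnegrE ?normc_ge0 ?(ltW M0).
  lra.
have := Re_exponent_ge s1 scA.
set E := complex.Re (_ * _ + (1 - _ ^+ 2) * _) => EE.
have : - (C + 1) <= E - alpha / 2 * normc (z0 + w) ^+ 2.
  by move: Cw EE; lra.
by move=> /(ler_wpM2r p0); congr (_ <= _); ring.
Qed.

End Growth.

(** * Divergence of the normalized norms *)

Lemma fock_bounded_iter (R : realType) (alpha p : R)
    (T : (R[i] -> R[i]) -> (R[i] -> R[i])) f n :
  fock_bounded alpha p T -> fock_space alpha p f ->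
  fock_space alpha p (iter n T f).
Proof.
by move=> [T_stable _ _] hf; elim: n => [//|n IHn]; exact: T_stable IHn.
Qed.

Theorem theorem4p3 (R : realType) (alpha p : R)
    (halpha : 0 < alpha) (hp : 1 <= p)
    (a : R[i]) (lambda : R)
    (hlambda : -1 < lambda < 1) (hlambda0 : lambda != 0)
    (a0 a1 a2 : R[i]) :
  let beta : R := 1 - `|lambda| ^+ 2 in
  let phi : R[i] -> R[i] := fun z => a + lambda%:C * z in
  let psi : R[i] -> R[i] := fun z => expC (a0 + a1 * z + a2 * z ^+ 2) in
  let W := weighted_comp psi phi in
  let z0 : R[i] := a / (1 - lambda%:C) in
  normc a2 = alpha / 2 * beta ->
  fock_bounded alpha p W ->
  forall f : R[i] -> R[i],
    fock_space alpha p f -> f z0 != 0 ->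
    normc (psi z0) ^- n * fock_norm alpha p (iter n W f) @[n --> \oo] --> +oo.
Proof.
move=> beta phi psi W z0 na2 Wbnd f hf fz0.
have labs : `|lambda| < 1 by rewrite ltr_norml.
have p0 : 0 < p by rewrite (lt_le_trans _ hp).
have l1 : 1 - lambda%:C != 0.
  by rewrite -(rmorph1 (real_complex R)) -rmorphB fmorph_eq0; lra.
have l2E : 1 - lambda%:C ^+ 2 = (1 - lambda ^+ 2)%:C.
  by rewrite rmorphB rmorph1 rmorphXn.
have b0 : 0 < 1 - lambda ^+ 2 by nra.
have l2 : 1 - lambda%:C ^+ 2 != 0 by rewrite l2E fmorph_eq0 gt_eqF.
(* The exponent of [psi] at [z0 + w] is [q + (a1 + 2 * a2 * z0) * w + a2 * w ^+ 2]; [c] and [A] are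
   its coefficients after the division that makes the iterates telescope. *)
pose A := a2 / (1 - lambda%:C ^+ 2).
pose c := (a1 + 2 * a2 * z0) / (1 - lambda%:C).
pose q := a0 + a1 * z0 + a2 * z0 ^+ 2.
have nA : normc A = alpha / 2.
  rewrite normcM normcV l2E normc_real gtr0_norm // na2 /beta.
  by rewrite real_normK ?num_real // mulfK // gt_eqF.
have phiE w : phi (z0 + w) = z0 + lambda%:C * w.
  by rewrite /phi /z0; field.
have psiE w : psi (z0 + w) = expC (q + (1 - lambda%:C) * c * w
                                     + (1 - lambda%:C ^+ 2) * A * w ^+ 2).
  have -> : (1 - lambda%:C) * c = a1 + 2 * a2 * z0 by rewrite mulrC divfK.
  have -> : (1 - lambda%:C ^+ 2) * A = a2 by rewrite mulrC divfK.
  by rewrite /psi /q; congr expC; ring.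
have [d [nd [delta delta0 Hd]]] :=
  normalized_iter_lower_bound halpha hp labs c nA hf.1 fz0.
set P := normc (psi z0).
have P0 : 0 < P by rewrite /P normc_expC expR_gt0.
have iterE n w : normc (iter n W f (z0 + w)) =
    P ^+ n * normc (normalized_iter lambda c A z0 f n w).
  rewrite (iter_weighted_comp_affine f _ _ phiE psiE) expCD -mulrA normcM.
  by rewrite normc_expC_natmul.
have lower (N : nat) : \forall n \near \oo,
    (((P ^+ n) `^ p * delta * (4 * N%:R))%:E <=
      fock_integral alpha p (iter n W f))%E.
  move: (Hd N); apply: filterS => n Hn.
  have nd2 : complex.Re d ^+ 2 + complex.Im d ^+ 2 = 1.
    by rewrite -normc_sqr nd expr1n.
  rewrite EFinM.
  rewrite -(measure_squares_on_line (complex.Re z0) (complex.Im z0) N nd2).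
  apply: ge0_integral_ge_on => //.
  - by apply: bigsetU_measurable => k _; exact: measurable_square_at.
  - by rewrite mulr_ge0 ?powR_ge0 ?ltW.
  - by move=> z; rewrite mulr_ge0 ?powR_ge0 ?expR_ge0.
  pose F k := square_at (complex.Re z0 + 4 * k%:R * complex.Re d)
                        (complex.Im z0 + 4 * k%:R * complex.Im d).
  move=> [u v]; rewrite -(bigcup_mkord N F) => -[k kN] /square_atP[hu hv].
  pose h : R[i] := (u - (complex.Re z0 + 4 * k%:R * complex.Re d)) +i*
                   (v - (complex.Im z0 + 4 * k%:R * complex.Im d)).
  have zE : u +i* v = z0 + ((4 * k%:R)%:C * d + h).
    rewrite /h; case: (z0) (d) => [x y] [dx dy]; simpc => /=.
    by congr (_ +i* _); ring.
  rewrite zE iterE powRM ?normc_ge0 ?exprn_ge0 ?(ltW P0) // -[leRHS]mulrA.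
  by rewrite ler_wpM2l ?powR_ge0 //; exact: (Hn k h kN hu hv).
apply/cvgryPge => B.
pose kappa := alpha * p / (2 * pi) * delta * 4.
have kappa1 : 0 < alpha * p / (2 * pi) by rewrite divr_gt0 ?mulr_gt0 ?pi_gt0.
have kappa0 : 0 < kappa by rewrite /kappa mulr_gt0 // mulr_gt0.
(* The [p]-th power of the normalized norm will be at least [kappa * N%:R], so [N] is taken large
   enough for this to exceed the [p]-th power of [|B|]. *)
pose N := (Num.truncn (`|B| `^ p / kappa)).+1.
have BN : `|B| `^ p <= kappa * N%:R.
  by rewrite mulrC -ler_pdivrMr // ltW // truncnS_gt.
move: (lower N); apply: filterS => n.
(* Finiteness is essential here: [fine] would turn an infinite integral into 0 and lose the lower
   bound. *)
have [_ Ifin] := fock_bounded_iter n Wbnd hf.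
have I0 : (0 <= fock_integral alpha p (iter n W f))%E.
  by apply: integral_ge0 => z _; rewrite lee_fin mulr_ge0 ?powR_ge0 ?expR_ge0.
rewrite -[X in (_ <= X)%E]fineK ?ge0_fin_numE // lee_fin /fock_norm => In.
have Pn0 : 0 < P ^+ n by rewrite exprn_gt0.
apply: le_trans (ler_norm B) _; rewrite mulrC ler_pdivlMr //.
have pVp (x : R) : 0 <= x -> (x `^ p) `^ p^-1 = x.
  by move=> x0; rewrite -powRrM divff ?gt_eqF // powRr1.
(* Both sides become [p]-th roots, so that only the radicands remain to be compared. *)
rewrite -(pVp `|B|) // -(pVp _ (ltW Pn0)) -powRM ?powR_ge0 //.
apply: ge0_ler_powR; rewrite ?nnegrE ?invr_ge0 ?(ltW p0) //.
- by rewrite mulr_ge0 ?powR_ge0.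
- by rewrite mulr_ge0 ?fine_ge0 // ltW.
apply: le_trans (ler_wpM2l (ltW kappa1) In).
apply: le_trans (ler_wpM2r (powR_ge0 _ _) BN) _.
by rewrite /kappa le_eqVlt; apply/orP; left; apply/eqP; ring.
Qed.
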